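(* There exists a computable function $B\colon\mathbb N\to\mathbb N$ such that for every formula $\varphi$ of $\mathcal L$: if $\varphi$ is satisfiable (respectively, falsifiable) in some intuitionistic dynamic model, then $\varphi$ is satisfiable (respectively, falsifiable) in an intuitionistic dynamic model $(W,\preccurlyeq,S,V)$ with $|W|\le B(|\varphi|)$, where $|\varphi|$ denotes the number of subformulas of $\varphi$.
   Context: Formulas of $\mathcal L$: $\varphi::= p\mid\bot\mid\varphi\wedge\varphi\mid\varphi\vee\varphi\mid\varphi\to\varphi\mid\bigcirc\varphi\mid\Diamond\varphi\mid\Box\varphi$, $p$ in a countable set $\mathbb P$. An intuitionistic dynamic model is $(W,\preccurlyeq,S,V)$ with $W\ne\emptyset$, $\preccurlyeq$ a partial order on $W$, $S\colon W\to W$ such that $w\preccurlyeq v\Rightarrow S(w)\preccurlyeq S(v)$, and $V\colon W\to2^{\mathbb P}$ with $w\preccurlyeq v\Rightarrow V(w)\subseteq V(v)$. With $S^0(w)=w$, $S^{k+1}(w)=S(S^k(w))$: $w\models p$ iff $p\in V(w)$; $\bot$ never; $\wedge,\vee$ as usual; $w\models\varphi\to\psi$ iff for all $v\succcurlyeq w$, $v\models\varphi$ implies $v\models\psi$; $w\models\bigcirc\varphi$ iff $S(w)\models\varphi$; $w\models\Diamond\varphi$ iff $S^k(w)\models\varphi$ for some $k\ge0$; $w\models\Box\varphi$ iff $S^k(w)\models\varphi$ for all $k\ge0$. Satisfiable in a model: true at some world; falsifiable: false at some world. *)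

(* Defs.v *)
From HB Require Import structures.
From mathcomp Require Import all_boot.

Set Implicit Arguments.
Unset Strict Implicit.
Unset Printing Implicit Defensive.

Inductive formula (P : Type) : Type :=
| Var of P
| Bot
| And of formula P & formula P
| Or of formula P & formula P
| Imp of formula P & formula P
| Next of formula P
| Dia of formula P
| Box of formula P.

Arguments Bot {P}.

Section FormulaEq.
Variable P : eqType.

Fixpoint formula_eqb (f g : formula P) : bool :=
  match f, g with
  | Var p, Var q => p == q
  | Bot, Bot => true
  | And f1 f2, And g1 g2
  | Or f1 f2, Or g1 g2
  | Imp f1 f2, Imp g1 g2 => formula_eqb f1 g1 && formula_eqb f2 g2
  | Next f1, Next g1
  | Dia f1, Dia g1
  | Box f1, Box g1 => formula_eqb f1 g1
  | _, _ => false
  end.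

Lemma formula_eqbP : Equality.axiom formula_eqb.
Proof.
move=> f g; apply: (iffP idP) => [|<-]; last first.
  by elim: f => //= f1 -> // f2 ->.
elim: f g => [p||f1 I1 f2 I2|f1 I1 f2 I2|f1 I1 f2 I2|f1 I1|f1 I1|f1 I1]
  [q||g1 g2|g1 g2|g1 g2|g1|g1|g1] //=.
- by move/eqP->.
- by case/andP=> /I1-> /I2->.
- by case/andP=> /I1-> /I2->.
- by case/andP=> /I1-> /I2->.
- by move/I1->.
- by move/I1->.
- by move/I1->.
Qed.

HB.instance Definition _ := hasDecEq.Build (formula P) formula_eqbP.

End FormulaEq.

(* All occurrences of subformulas, the formula itself included. *)
Fixpoint subformulas (P : Type) (phi : formula P) : seq (formula P) :=
  phi :: match phi with
         | Var _ | Bot => [::]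
         | And f g | Or f g | Imp f g => subformulas f ++ subformulas g
         | Next f | Dia f | Box f => subformulas f
         end.

(* Subformulas are counted as formulas, not as occurrences. *)
Definition formula_size (P : eqType) (phi : formula P) : nat :=
  size (undup (subformulas phi)).

Record dynamic_model (P W : Type) : Type := DynamicModel {
  dm_nonempty : inhabited W;
  dm_le : W -> W -> Prop;
  dm_le_refl : forall w, dm_le w w;
  dm_le_trans : forall u v w, dm_le u v -> dm_le v w -> dm_le u w;
  dm_le_antisym : forall v w, dm_le v w -> dm_le w v -> v = w;
  dm_succ : W -> W;
  dm_succ_mono : forall w v, dm_le w v -> dm_le (dm_succ w) (dm_succ v);
  dm_val : W -> P -> Prop;
  dm_val_mono : forall w v, dm_le w v -> forall p, dm_val w p -> dm_val v p
}.

Fixpoint holds (P W : Type) (M : dynamic_model P W) (w : W)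
    (phi : formula P) : Prop :=
  match phi with
  | Var p => dm_val M w p
  | Bot => False
  | And f g => holds M w f /\ holds M w g
  | Or f g => holds M w f \/ holds M w g
  | Imp f g => forall v, dm_le M w v -> holds M v f -> holds M v g
  | Next f => holds M (dm_succ M w) f
  | Dia f => exists k : nat, holds M (iter k (dm_succ M) w) f
  | Box f => forall k : nat, holds M (iter k (dm_succ M) w) f
  end.

Definition satisfiable_in (P W : Type) (M : dynamic_model P W)
    (phi : formula P) : Prop :=
  exists w : W, holds M w phi.

Definition falsifiable_in (P W : Type) (M : dynamic_model P W)
    (phi : formula P) : Prop :=
  exists w : W, ~ holds M w phi.

(* Kleene's partial recursive functions, indexed by arity.  In [RPrec f g]
   and [RMin f] the recursion, resp. search, variable is the first one. *)
Inductive recfun : nat -> Type :=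
| RZero n : recfun n
| RSucc : recfun 1
| RProj n : 'I_n -> recfun n
| RComp m n : recfun m -> ('I_m -> recfun n) -> recfun n
| RPrec n : recfun n -> recfun n.+2 -> recfun n.+1
| RMin n : recfun n.+1 -> recfun n.

(* [computes f v y]: the partial function coded by [f] is defined at [v],
   with value [y]. *)
Fixpoint computes (n : nat) (f : recfun n) : n.-tuple nat -> nat -> Prop :=
  match f in recfun n return n.-tuple nat -> nat -> Prop with
  | RZero _ => fun _ y => y = 0
  | RSucc => fun v y => y = (thead v).+1
  | RProj _ i => fun v y => y = tnth v i
  | RComp m _ g h => fun v y =>
      exists u : m.-tuple nat,
        (forall i, computes (h i) v (tnth u i)) /\ computes g u y
  | RPrec _ g h => fun v y =>
      exists s : nat -> nat,
        [/\ computes g (behead_tuple v) (s 0),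
            forall k, k < thead v ->
              computes h [tuple of k :: s k :: behead_tuple v] (s k.+1)
          & y = s (thead v)]
  | RMin _ g => fun v y =>
      computes g [tuple of y :: v] 0 /\
      forall k, k < y -> exists z, computes g [tuple of k :: v] z.+1
  end.

Definition computable (B : nat -> nat) : Prop :=
  exists f : recfun 1, forall n, computes f [tuple n] (B n).

(* Main.v *)
Require Import Defs.
From HB Require Import structures.
From mathcomp Require Import all_boot.
From mathcomp Require Import boolp.

(* Label each world with its type, the set of subformulas of phi true there.
   Types grow along the order and so change at most n times along a chain; hence
   the moment of a world -- its type together with the moments of the
   worlds of another type above it -- ranges over a set whose size is a tower of
   height n.  Equality of moments is a bisimulation for the order but is not
   compatible with S, so a quotient is not enough.

   Follow the orbit of w until a moment recurs infinitely often, at x0.  Choose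
   a finite tree of worlds above x0 realizing its moment and let it flow along
   S, long enough to fulfil every eventuality (true Dia, false Box) of its
   nodes, until the moment of the root recurs; over each flowing node hang a
   fresh tree realizing its current moment, to refute implications.  At the end
   of the loop everything is mapped back into the initial tree by recording the
   moments met along a chain and dropping repetitions of types.  An eventuality
   still pending on a hung node survives until this return, where it becomes
   one of a flowing node.  Only the moments of the flowing nodes matter, so the
   loop (and the segment before it) can be shortened as a path in a finite graph
   of configurations, which bounds the number of levels. *)

Set Implicit Arguments.
Unset Strict Implicit.
Unset Printing Implicit Defensive.

(** * Short paths in a finite graph *)

Section ShortPaths.
Variables (C : finType) (e : rel C).

Lemma connect_short_path x y : connect e x y ->
  exists p, [/\ path e x p, last x p = y & size p <= #|C|].
Proof.
case/connectP=> p ep ->; case: (shortenP ep) => p' ep' Up' _.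
exists p'; split=> //.
by rewrite ltnW // (leq_trans _ (max_card (mem (x :: p')))) // (card_uniqP Up').
Qed.

Variable c : nat -> C.
Hypothesis ec : forall k, e (c k) (c k.+1).

(** Each point not yet visited costs one more short path and enlarges the visited set, so at most
    [#|C|] paths are appended. Keeping the end of [p] connected to [c j] allows the next
    extension. *)
Lemma covering_path j : exists p,
  [/\ path e (c 0) p, forall k, k <= j -> c k \in c 0 :: p,
      connect e (last (c 0) p) (c j)
    & size p <= #|C| * #|[set x in c 0 :: p]|].
Proof.
elim: j => [|j [p [ep cov con szp]]].
  exists [::]; split=> //= k; rewrite leqn0 => /eqP->; exact: mem_head.
have con' : connect e (last (c 0) p) (c j.+1).
  exact: connect_trans con (connect1 (ec j)).
have [cin|cnin] := boolP (c j.+1 \in c 0 :: p).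
  exists p; split=> // k; rewrite leq_eqVlt => /orP[/eqP->//|]; exact: cov.
have [p' [ep' lp' szp']] := connect_short_path con'.
have sub z : z \in c 0 :: p -> z \in c 0 :: p ++ p'.
  by rewrite -cat_cons mem_cat => ->.
have cin' : c j.+1 \in c 0 :: p ++ p'.
  by rewrite -lp' -last_cat mem_last.
exists (p ++ p'); split.
- by rewrite cat_path ep.
- move=> k; rewrite leq_eqVlt => /orP[/eqP->//|kj]; exact/sub/cov.
- by rewrite last_cat lp' connect0.
- rewrite size_cat (leq_trans (leq_add szp szp')) // -mulnSr leq_mul2l.
  apply/orP; right; apply: proper_card; apply/properP; split.
    by apply/subsetP=> z; rewrite !in_set; apply: sub.
  by exists (c j.+1); rewrite in_set.
Qed.

Lemma shortcut j : exists L (d : nat -> C),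
  [/\ L <= #|C| * #|C| + #|C|, d 0 = c 0, d L.+1 = c j.+1,
      forall r, r <= L -> e (d r) (d r.+1)
    & forall k, k <= j -> exists2 r, r <= L & d r = c k].
Proof.
have [p [ep cov con szp]] := covering_path j.
have [p' [ep' lp' szp']] := connect_short_path con.
pose s := p ++ p'; pose q := rcons s (c j.+1).
have lastq : last (c 0) s = c j by rewrite last_cat.
have eq : path e (c 0) q by rewrite rcons_path cat_path ep ep' lastq ec.
exists (size s), (nth (c 0) (c 0 :: q)); split=> //.
- rewrite size_cat leq_add // (leq_trans szp) // leq_mul2l max_card orbT //.
- by rewrite /= nth_rcons ltnn eqxx.
- move=> r rs; apply: (pathP (c 0) eq); by rewrite size_rcons ltnS.
- move=> k kj; have := cov k kj; set x := c k => xin.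
  have xs : x \in c 0 :: s by rewrite -cat_cons mem_cat xin.
  exists (index x (c 0 :: s)).
    by rewrite -ltnS -[(size s).+1]/(size (c 0 :: s)) index_mem.
  rewrite /q -rcons_cons nth_rcons index_mem xs; exact: nth_index.
Qed.

End ShortPaths.

(** * Moments and the size bound *)

Fixpoint moment (n k : nat) : finType :=
  match k with
  | 0 => {set 'I_n} : finType
  | k'.+1 => ({set 'I_n} * {set moment n k'})%type : finType
  end.

Fixpoint moment_card (n k : nat) : nat :=
  if k is k'.+1 then 2 ^ n * 2 ^ moment_card n k' else 2 ^ n.

Lemma card_moment n k : #|moment n k| = moment_card n k.
Proof.
have cs (T : finType) : #|{set T}| = 2 ^ #|T|.
  by rewrite -[2]card_bool -card_ffun; apply: (bij_eq_card (f := @finfun_of_set T));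
     exists (fun f => FinSet f) => [[]|].
by elim: k => [|k IH] /=; rewrite ?card_prod !cs card_ord ?IH.
Qed.

(** Here [q] counts moments, [u] bounds the words of length at most [n] over them (the nodes of a
    tree), and [K] bounds the configurations, which map nodes to moments. The loop and the segment
    before it have at most [K * K + K + 1] levels each; a world is a level with two words. *)
Definition model_bound (n : nat) : nat :=
  let q := moment_card n n in
  let u := n.+1 * q ^ n in
  let K := q ^ u in
  ((K * K + K).+1 + (K * K + K).+1) * u * u.

Lemma moment_card_gt0 n k : 0 < moment_card n k.
Proof. by case: k => [|k] /=; rewrite ?muln_gt0 !expn_gt0. Qed.

Lemma card_bseq_le n (T : finType) : 0 < #|T| -> #|{: n.-bseq T}| <= n.+1 * #|T| ^ n.
Proof.
move=> T0; rewrite card_bseq -[X in X * _]card_ord -sum_nat_const leq_sum // => i _.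
by rewrite leq_pexp2l // -ltnS ltn_ord.
Qed.

(** By pigeonhole some value occurs arbitrarily late. The lengths [i.+1] and [j.+1] are positive
    because a shortened segment always ends with an edge. *)
Lemma recurrent_value (Q : finType) (c : nat -> Q) :
  exists i, forall N, exists2 j, N <= j & c (j.+1 + i.+1) = c i.+1.
Proof.
have [q qrec] : exists q, forall N, exists2 j, N <= j & c j = q.
  apply: contrapT => /forallNP no.
  have bnd q : exists N, forall j, N <= j -> c j <> q.
    have /existsNP[N hN] := no q; exists N => j Nj cj; apply: hN; by exists j.
  have [f fP] := choice bnd.
  by have := fP (c (\max_q f q)) _ (leq_bigmax _).
have [[//|i] _ ci] := qrec 1; exists i => N.
have [j Nj cj] := qrec (N + i.+2); have ij := leq_trans (leq_addl _ _) Nj.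
exists (j - i.+2); first by rewrite leq_subRL // addnC.
by rewrite addSnnS subnK ?cj.
Qed.

(** * Moments as a bisimulation for the order *)

Section Moments.
Variables (n : nat) (W : Type) (le : rel W) (t : W -> {set 'I_n}).
Hypothesis le_refl : reflexive le.
Hypothesis le_trans : transitive le.
Hypothesis t_mono : forall x y, le x y -> t x \subset t y.

Fixpoint mom k : W -> moment n k :=
  match k return W -> moment n k with
  | 0 => t
  | k'.+1 => fun x =>
      (t x, [set q | `[< exists y, [/\ le x y, t y != t x & mom k' y = q] >]])
  end.

Lemma mom_type k x y : mom k x = mom k y -> t x = t y.
Proof. by case: k => // k []. Qed.

Lemma mom_lift k x x' y : mom k.+1 x = mom k.+1 x' -> le x y -> t y != t x ->
  exists y', [/\ le x' y', t y' != t x' & mom k y' = mom k y].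
Proof.
case=> _ /setP /(_ (mom k y)) + xy ty; rewrite !in_set.
rewrite asboolT; last by exists y.
by move/esym/asboolP.
Qed.

Lemma card_type_lt x y : le x y -> t y != t x -> #|t x| < #|t y|.
Proof. by move=> xy ty; rewrite proper_card // properEneq eq_sym ty t_mono. Qed.

Lemma card_type x : #|t x| <= n.
Proof. by rewrite -[X in _ <= X]card_ord max_card. Qed.

(** Each change of type enlarges the type, so at most [n - #|t x|] changes remain above [x]. A
    lifted world has fewer changes left, which drives the induction. *)
Lemma mom_stable k x x' : n - #|t x| <= k -> mom k x = mom k x' ->
  forall j, mom j x = mom j x'.
Proof.
elim: k x x' => [|k IH] x x' nk Exx' [|j]; try exact: mom_type Exx'.
- rewrite /=; congr pair; first exact: Exx'.
  apply/setP=> q; rewrite !in_set; apply: asbool_equiv_eq.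
  have full z y : t z = t x -> le z y -> t y != t z -> False.
    move=> tz zy /(card_type_lt zy); rewrite tz => lt.
    by have := leq_trans lt (card_type y); rewrite ltnNge -subn_eq0 -leqn0 nk.
  have Et := mom_type Exx'.
  by split=> [] [y [h1 h2 _]]; case: (full _ _ _ h1 h2).
rewrite /=; congr pair; first exact: mom_type Exx'.
apply/setP=> q; rewrite !in_set; apply: asbool_equiv_eq.
have half z z' : t z = t x -> mom k.+1 z = mom k.+1 z' ->
  (exists y, [/\ le z y, t y != t z & mom j y = q]) ->
  exists y, [/\ le z' y, t y != t z' & mom j y = q].
  move=> tz Ez [y [zy ty <-]]; have [y' [z'y' ty' Ey]] := mom_lift Ez zy ty.
  exists y'; split=> //; apply/esym/IH; last exact/esym.
  have := card_type_lt zy ty; rewrite tz => lt.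
  move: nk; rewrite !leq_subLR addnS -addSn => nk.
  by rewrite (leq_trans nk) // leq_add2r.
split; apply: half => //; exact/esym/mom_type/Exx'.
Qed.

Let Q := moment n n.
Let mm : W -> Q := mom n.

(** Stability raises the equality to depth [n.+1], so lifting loses no depth. *)
Lemma moment_lift x x' y : mm x = mm x' -> le x y -> t y != t x ->
  exists2 y', le x' y' & mm y' = mm y.
Proof.
move=> E; have E' := mom_stable (leq_subr _ _) E n.+1.
by move=> xy ty; have [y' [h1 _ h3]] := mom_lift E' xy ty; exists y'.
Qed.

(** Half of moment equality. It survives when [x] moves up inside its type, although the moment of
    [x] may then lose elements; this lets repeated types be dropped from a chain. *)
Definition covers x' x := t x' = t x /\
  forall y, le x y -> t y != t x -> exists2 y', le x' y' & mm y' = mm y.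

Lemma moment_covers x x' : mm x' = mm x -> covers x' x.
Proof.
move=> E; split=> [|y xy ty]; first exact: mom_type E.
exact: moment_lift (esym E) xy ty.
Qed.

Lemma covers_le x' x y : covers x' x -> le x y -> t y = t x -> covers x' y.
Proof.
case=> [tx cx] xy ty; split=> [|z yz]; first by rewrite ty.
rewrite ty; exact/cx/(le_trans xy).
Qed.

(** * Walks guided by words of moments *)

Definition step_spec (x : W) (q : Q) (y : W) := [/\ le x y,
  (exists y', [/\ le x y', t y' != t x & mm y' = q]) -> mm y = q
  & (exists2 y', le x y' & t y' != t x) -> t y != t x].

Lemma step_exists x q : exists y, step_spec x q y.
Proof.
have [[y [xy ty yq]]|no] := pselect (exists y', [/\ le x y', t y' != t x & mm y' = q]).
  by exists y; split.
have [[y xy ty]|no'] := pselect (exists2 y', le x y' & t y' != t x).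
  by exists y; split.
by exists x; split.
Qed.

(* A step always moves to a new type when it can, even if [q] is not realized
   above [x]; hence a walk of length [n] ends where no new type is left. *)
Definition step (x : W) (q : Q) : W := sval (cid (step_exists x q)).
Definition walk : W -> seq Q -> W := foldl step.

Lemma stepP x q : step_spec x q (step x q).
Proof. exact: svalP (cid (step_exists x q)). Qed.

Lemma walk_cat x s1 s2 : walk x (s1 ++ s2) = walk (walk x s1) s2.
Proof. exact: foldl_cat. Qed.

Lemma le_walk x s : le x (walk x s).
Proof.
elim: s x => //= q s IH x; apply: le_trans (IH _); by case: (stepP x q).
Qed.

Lemma trace_path x s : path le x (scanl step x s).
Proof. by elim: s x => //= q s IH x; rewrite IH; case: (stepP x q) => ->. Qed.

Lemma last_trace x s : last x (scanl step x s) = walk x s.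
Proof. by elim: s x => /=. Qed.

Definition terminal x := forall y, le x y -> t y = t x.

Lemma walk_terminal x s : terminal (walk x s) \/ size s <= #|t (walk x s)|.
Proof.
elim/last_ind: s => [|s q IH]; first by right.
rewrite -cats1 walk_cat /= cats1 size_rcons.
set u := walk x s in IH *; have [uv _ tv] := stepP u q.
have [tu|ntu] := pselect (terminal u).
  by left=> y vy; rewrite !tu //; apply: le_trans vy.
case: IH => // szs; right; apply: leq_ltn_trans szs _.
apply: card_type_lt => //; apply: tv.
have /existsNP[y /not_implyP[uy /eqP ty]] := ntu; by exists y.
Qed.

(** A word of length [n] ends at a terminal world or at one of full type, so no other type lies
    above it; after a shorter word, one more letter realizes the moment of [y]. *)
Lemma walk_witness x s y : size s <= n -> le (walk x s) y ->
  t y != t (walk x s) ->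
  exists2 s', size (s ++ s') <= n & t (walk x (s ++ s')) = t y.
Proof.
move=> szs sy ty; exists [:: mm y].
  rewrite cats1 size_rcons ltn_neqAle szs andbT; apply/eqP=> szn.
  have [/(_ y sy)/eqP|] := walk_terminal x s; first by rewrite (negPf ty).
  rewrite szn leqNgt => /negP[].
  exact: leq_trans (card_type_lt sy ty) (card_type _).
rewrite walk_cat /=; have [_ h _] := stepP (walk x s) (mm y).
by apply: mom_type; apply: h; exists y.
Qed.

Fixpoint moment_word (x : W) (c : seq W) : seq Q :=
  if c is y :: c' then
    if t y == t x then moment_word y c' else mm y :: moment_word y c'
  else [::].

Lemma moment_word_cat x c1 c2 :
  moment_word x (c1 ++ c2) = moment_word x c1 ++ moment_word (last x c1) c2.
Proof. by elim: c1 x => //= y c IH x; case: eqP; rewrite IH. Qed.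

(** Moves inside a type are skipped by [covers_le]. At a change of type, covering provides a world
    above [x'] with the recorded moment, so the step attains that moment and covers again. *)
Lemma moment_word_covers x' x c : path le x c -> covers x' x ->
  covers (walk x' (moment_word x c)) (last x c).
Proof.
elim: c x x' => //= y c IH x x' /andP[xy yc] cx.
case: eqP => [ty|/eqP ty] /=; apply: IH => //; first exact: covers_le cx _ _.
have [tx /(_ _ xy ty)[y' xy' my']] := cx.
have [_ h _] := stepP x' (mm y); apply/moment_covers/h.
by exists y'; rewrite (mom_type my') tx.
Qed.

Lemma size_moment_word x c : path le x c -> size (moment_word x c) <= n.
Proof.
move=> xc; apply: leq_trans (card_type (last x c)).
apply: leq_trans (leq_addr #|t x| _) _.
elim: c x xc => [|y c IH] x //= /andP[xy yc]; case: eqP => [<-|/eqP ty] /=.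
  exact: IH.
apply: leq_trans (IH y yc); rewrite addSnnS leq_add2l; exact: card_type_lt.
Qed.

(** * The finite unfolding: order, successor and labels *)

Section Unfolding.
Variable S : W -> W.
Hypothesis S_mono : {homo S : x y / le x y}.

(** What remains of a tree of walks under [S]: the images need not be walks, but they still grow
    along prefixes. *)
Definition branching (f : seq Q -> W) := forall s q, le (f s) (f (rcons s q)).

Lemma branching_walk x : branching (walk x).
Proof. by move=> s q; rewrite -cats1 walk_cat le_walk. Qed.

Lemma branching_cat f : branching f -> forall s s', le (f s) (f (s ++ s')).
Proof.
move=> fb s s'; elim: s' s => [|q s' IH] s; first by rewrite cats0 le_refl.
by rewrite -cat_rcons (le_trans (fb s q)).
Qed.

Definition prefixes : seq Q -> seq (seq Q) := scanl rcons [::].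

Lemma foldl_rcons (s s' : seq Q) : foldl rcons s s' = s ++ s'.
Proof. by elim: s' s => [|q s' IH] s /=; rewrite ?cats0 // IH cat_rcons. Qed.

Lemma prefixes_path f a : branching f -> path le (f [::]) (map f (prefixes a)).
Proof.
by move=> fb; rewrite /prefixes; elim: a [::] => //= q a IH s; rewrite fb IH.
Qed.

Lemma last_prefixes (f : seq Q -> W) a : last (f [::]) (map f (prefixes a)) = f a.
Proof.
rewrite last_map -[in RHS](cat0s a) -foldl_rcons /prefixes.
by congr f; elim: a [::] => /=.
Qed.

Lemma prefixes_cat (a a' : seq Q) : exists c, prefixes (a ++ a') = prefixes a ++ c.
Proof. by rewrite /prefixes scanl_cat; eexists. Qed.

Let U := n.-bseq Q.
Variables (F : nat -> seq Q -> W) (T I : nat) (x0 : W).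
Hypothesis IT : I < T.
(* Levels [I <= l < T] form the loop; [F l a] is the flowing node [a] at level [l]. *)
Hypothesis F_branching : forall l, branching (F l).
Hypothesis F_next : forall l, l.+1 < T -> l.+1 != I ->
  forall a : U, mm (F l.+1 a) = mm (S (F l a)).
Hypothesis F_return : forall l, l < T -> l.+1 = T \/ l.+1 = I ->
  mm x0 = mm (S (F l [::])).
Hypothesis F_start : forall a : U, mm (F I a) = mm (walk x0 a).
Hypothesis F_eventually : forall (a : U) i k,
  exists2 r, I + r < T & (i \in t (F (I + r) a)) = (i \in t (iter k S (walk x0 a))).

(* A world [(l, a, b)] is the node [b] of the tree hung at level [l] over the
   flowing node [a]. *)
Definition world : finType := ('I_T * U * U)%type.
Implicit Types v w : world.

Definition label v : W := walk (F v.1.1 v.1.2) v.2.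

(** Only the root of a hung tree, the flowing node itself, sees other hung trees: the label of a
    proper node over [a] need not lie below any flowing extension of [a]. *)
Definition world_le v w : bool := (v.1.1 == w.1.1) &&
  ((nilp v.2 && prefix v.1.2 w.1.2) || ((v.1.2 == w.1.2) && prefix v.2 w.2)).

(** The default of [insubd] sends the last level back to [I]. A level just before [I] also gets the
    value [I], so [world_succ] treats entering the loop and closing it alike. *)
Definition next_level (l : 'I_T) : 'I_T := insubd (Ordinal IT) l.+1.

Definition parallel l a b : seq Q :=
  moment_word (S (F l a)) (map S (scanl step (F l a) b)).

(** Unlike in [parallel], the chain starts at the root of the flowing tree and climbs through the
    prefixes of [a], so that its word can be replayed from [x0]. *)
Definition collapse l a b : seq Q :=
  moment_word (S (F l [::])) (map S (map (F l) (prefixes a) ++ scanl step (F l a) b)).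

Definition world_succ v : world :=
  let: (l, a, b) := v in
  if next_level l == Ordinal IT
  then (Ordinal IT, insub_bseq n (collapse l a b), [bseq])
  else (next_level l, a, insub_bseq n (parallel l a b)).

Lemma insub_bseqK (s : seq Q) : size s <= n -> insub_bseq n s = s :> seq Q.
Proof. by move=> sn; rewrite /insub_bseq insubdK. Qed.

Lemma size_parallel l a b : size (parallel l a b) <= n.
Proof. exact/size_moment_word/(homo_path S_mono)/trace_path. Qed.

Lemma collapse_path l a b : path le (S (F l [::]))
  (map S (map (F l) (prefixes a) ++ scanl step (F l a) b)).
Proof.
apply: (homo_path S_mono); rewrite cat_path prefixes_path // last_prefixes.
exact: trace_path.
Qed.

Lemma size_collapse l a b : size (collapse l a b) <= n.
Proof. exact/size_moment_word/collapse_path. Qed.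

Lemma prefix_parallel l a b b' : prefix b b' ->
  prefix (parallel l a b) (parallel l a b').
Proof.
case/prefixP=> c ->; rewrite /parallel scanl_cat map_cat moment_word_cat.
exact: prefix_prefix.
Qed.

Lemma prefix_collapse l a b b' : prefix b b' ->
  prefix (collapse l a b) (collapse l a b').
Proof.
case/prefixP=> c ->; rewrite /collapse scanl_cat catA.
rewrite [X in prefix _ (moment_word _ X)]map_cat moment_word_cat.
exact: prefix_prefix.
Qed.

Lemma prefix_collapse_nil l a a' b' : prefix a a' ->
  prefix (collapse l a [::]) (collapse l a' b').
Proof.
case/prefixP=> c ->; rewrite /collapse; have [d ->] := prefixes_cat a c.
rewrite /= cats0 (map_cat (F l)) -catA.
rewrite [X in prefix _ (moment_word _ X)]map_cat moment_word_cat.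
exact: prefix_prefix.
Qed.

Lemma world_le_refl v : world_le v v.
Proof. by rewrite /world_le !eqxx !prefix_refl orbT. Qed.

Lemma world_le_trans u v w : world_le u v -> world_le v w -> world_le u w.
Proof.
case: u v w => [[l a] b] [[l' a'] b'] [[l'' a''] b''].
case/andP=> /= /eqP-> h1 /andP[/= /eqP-> h2].
rewrite /world_le /= eqxx /=.
case/orP: h1 h2 => /andP[h1 h1'] /orP[]/andP[h2 h2'].
- by rewrite h1 (prefix_trans h1').
- by rewrite -(eqP h2) h1 h1'.
- rewrite (eqP h1) h2' andbT; apply/orP; left.
  by move: h1'; rewrite (nilP h2) prefixs0 => /eqP->.
- by rewrite (eqP h1) h2 (prefix_trans h1') // orbT.
Qed.

Lemma prefix_antisym (s s' : seq Q) : prefix s s' -> prefix s' s -> s = s'.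
Proof.
case/prefixP=> c -> /prefixP[d /(congr1 size)]; rewrite !size_cat -addnA => /eqP.
rewrite -[X in X == _]addn0 eqn_add2l eq_sym addn_eq0 => /andP[/nilP-> _].
by rewrite cats0.
Qed.

Lemma world_le_antisym v w : world_le v w -> world_le w v -> v = w.
Proof.
case: v w => [[l a] b] [[l' a'] b'] /andP[/= /eqP-> h1] /andP[/= _ h2].
case/orP: h1 h2 => /andP[h1 h1'] /orP[]/andP[h2 h2'].
- congr (_, _, _); apply: val_inj; first exact: prefix_antisym.
  by rewrite /= (nilP h1) (nilP h2).
- rewrite (eqP h2); congr (_, _); apply: val_inj.
  apply/esym/eqP; move: h2'; by rewrite /= (nilP h1) prefixs0.
- rewrite (eqP h1); congr (_, _); apply: val_inj.
  apply/eqP; move: h1'; by rewrite /= (nilP h2) prefixs0.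
- rewrite (eqP h1); congr (_, _); apply: val_inj; exact: prefix_antisym.
Qed.

Lemma world_succ_mono v w : world_le v w -> world_le (world_succ v) (world_succ w).
Proof.
case: v w => [[l a] b] [[l' a'] b'] /andP[/= /eqP<- h].
case: eqP => _; rewrite /world_le /= eqxx /=.
  rewrite !insub_bseqK ?size_collapse //.
  case/orP: h => /andP[h h']; last by rewrite (eqP h) prefix_collapse.
  by rewrite (nilP h) prefix_collapse_nil.
rewrite !insub_bseqK ?size_parallel //.
case/orP: h => /andP[h h']; last by rewrite h (eqP h) prefix_parallel // orbT.
by rewrite (nilP h) h'.
Qed.

Lemma label_mono v w : world_le v w -> le (label v) (label w).
Proof.
case: v w => [[l a] b] [[l' a'] b'] /andP[/= /eqP<- h]; rewrite /label /=.
case/orP: h => /andP[h /prefixP[c Ec]].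
  rewrite (nilP h) Ec; apply: le_trans (le_walk _ _).
  exact: (branching_cat (F_branching l)).
by rewrite (eqP h) Ec walk_cat le_walk.
Qed.

Lemma next_levelP (l : 'I_T) : next_level l != Ordinal IT ->
  [/\ l.+1 < T, l.+1 != I & next_level l = l.+1 :> nat].
Proof.
rewrite /next_level /insubd; case: insubP => [l' lT El' /=|]; last by rewrite eqxx.
by rewrite -val_eqE /= El' => ->.
Qed.

Lemma next_level_loop (l : 'I_T) : next_level l = Ordinal IT ->
  l.+1 = T \/ l.+1 = I.
Proof.
rewrite /next_level /insubd; case: insubP => [l' lT El' /= E|]; last first.
  by rewrite -leqNgt => Tl _; left; apply/eqP; rewrite eqn_leq Tl ltn_ord.
by right; rewrite -El' E.
Qed.

(** The recorded word, replayed from a world with the moment of the start of the image chain, ends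
    in a world covering the end of that chain, and covering includes equality of types. *)
Lemma label_succ v : t (label (world_succ v)) = t (S (label v)).
Proof.
case: v => [[l a] b]; rewrite /label /=; case: eqP => [El|/eqP El] /=.
  rewrite (mom_type (F_start _)) insub_bseqK ?size_collapse // /collapse.
  have cov := moment_covers (F_return (ltn_ord l) (next_level_loop El)).
  have [-> _] := moment_word_covers (collapse_path l a b) cov.
  by rewrite last_map last_cat last_prefixes last_trace.
have [lT lI ->] := next_levelP El; rewrite insub_bseqK ?size_parallel //.
have cov := moment_covers (F_next lT lI a).
have [-> _] := moment_word_covers (homo_path S_mono (trace_path (F l a) b)) cov.
by rewrite last_map last_trace.
Qed.

Lemma label_witness v y : le (label v) y ->
  exists2 w, world_le v w & t (label w) = t y.
Proof.
have [Ety|ty] := eqVneq (t y) (t (label v)).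
  by exists v; rewrite ?world_le_refl.
case: v ty => [[l a] b] ty vy.
have [c szc tc] := walk_witness (size_bseq b) vy ty.
exists (l, a, insub_bseq n (b ++ c)).
  by rewrite /world_le /= !eqxx insub_bseqK // prefix_prefix orbT.
by rewrite /label /= insub_bseqK.
Qed.

(** Levels rise until a return, and every return lands on a flowing node. *)
Lemma reach_loop v : exists k a, iter k world_succ v = (Ordinal IT, a, [bseq]).
Proof.
have [m] := ubnP (T - v.1.1); elim: m v => // m IH [[l a] b] /= lm.
have [El|El] := eqVneq (next_level l) (Ordinal IT).
  by exists 1; rewrite /= El eqxx; eexists.
have [lT lI El'] := next_levelP El.
have [|k [a' ka']] := IH (world_succ (l, a, b)).
  rewrite /= (negPf El) /= El' -ltnS (leq_trans _ lm) // ltnS.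
  by rewrite ltn_sub2l // ltnW.
by exists k.+1, a'; rewrite iterSr.
Qed.

Lemma iter_flow (a : U) r (lt_r : I + r < T) :
  iter r world_succ (Ordinal IT, a, [bseq]) = (Ordinal lt_r, a, [bseq]).
Proof.
elim: r lt_r => [|r IH] lt_r /=.
  by congr (_, _, _); apply: val_inj; rewrite /= addn0.
have lt_r' : I + r < T by rewrite (leq_ltn_trans _ lt_r) // leq_add2l.
rewrite (IH lt_r') /= /next_level.
have -> : insubd (Ordinal IT) (I + r).+1 = Ordinal lt_r.
  by apply: val_inj; rewrite val_insubd -addnS lt_r.
have /negPf-> : Ordinal lt_r != Ordinal IT.
  by rewrite -val_eqE /= -[X in _ == X]addn0 eqn_add2l.
congr (_, _, _); apply: val_inj; exact: insub_bseqK.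
Qed.

Lemma label_eventually v i : exists k a,
  [/\ t (label (iter k world_succ v)) = t (walk x0 a)
    & forall j, exists k', (i \in t (label (iter k' world_succ v))) =
                           (i \in t (iter j S (walk x0 a)))].
Proof.
have [k [a Ek]] := reach_loop v; exists k, a; split.
  by rewrite Ek /label /= (mom_type (F_start a)).
move=> j; have [r lt_r Er] := F_eventually a i j.
by exists (r + k); rewrite iterD Ek (iter_flow a lt_r) /label /= Er.
Qed.

End Unfolding.

(** * Construction of the unfolding from shortened orbits *)

Section Existence.
Variable S : W -> W.
Hypothesis S_mono : {homo S : x y / le x y}.
Let U := n.-bseq Q.

(** What the truth lemma needs. Labels of successors are fixed by type only, so the iterates of [v]
    need not follow an orbit of [S]; [fu_eventually] ties them to the orbit of one world [x]
    instead. *)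
Record finite_unfolding (w0 : W) := FiniteUnfolding {
  fu_world : finType;
  fu_root : fu_world;
  fu_le : rel fu_world;
  fu_succ : fu_world -> fu_world;
  fu_label : fu_world -> W;
  fu_card : #|fu_world| <= model_bound n;
  fu_refl : forall v, fu_le v v;
  fu_trans : forall u v w, fu_le u v -> fu_le v w -> fu_le u w;
  fu_antisym : forall v w, fu_le v w -> fu_le w v -> v = w;
  fu_succ_mono : forall v w, fu_le v w -> fu_le (fu_succ v) (fu_succ w);
  fu_label_mono : forall v w, fu_le v w -> le (fu_label v) (fu_label w);
  fu_label_root : t (fu_label fu_root) = t w0;
  fu_label_succ : forall v, t (fu_label (fu_succ v)) = t (S (fu_label v));
  fu_witness : forall v y, le (fu_label v) y ->
    exists2 w, fu_le v w & t (fu_label w) = t y;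
  fu_eventually : forall v i, exists k x,
    t (fu_label (iter k fu_succ v)) = t x /\
    forall j, exists k', (i \in t (fu_label (iter k' fu_succ v))) =
                         (i \in t (iter j S x))
}.

(** Consecutive edges may be realized by different branching families, which makes shortcuts between
    equal configurations legitimate. *)
Definition config_step (c c' : {ffun U -> Q}) : bool := `[< exists f,
  [/\ branching f, forall a : U, mm (f a) = c a
    & forall a : U, mm (S (f a)) = c' a] >].

Lemma iter_branching f k : branching f -> branching (fun s => iter k S (f s)).
Proof. by move=> fb s q; elim: k => [|k IH] //=; exact: S_mono. Qed.

Lemma config_step_iter f k : branching f ->
  config_step [ffun a : U => mm (iter k S (f a))]
              [ffun a : U => mm (iter k.+1 S (f a))].
Proof.
move=> fb; apply/asboolP; exists (fun s => iter k S (f s)).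
by split=> [|a|a]; rewrite ?ffunE //; exact: iter_branching.
Qed.

Lemma shortened_orbit f j : branching f ->
  exists L (g : nat -> seq Q -> W),
  [/\ L <= #|{ffun U -> Q}| * #|{ffun U -> Q}| + #|{ffun U -> Q}|
        /\ forall r, branching (g r),
      forall a : U, mm (g 0 a) = mm (f a),
      forall a : U, mm (S (g L a)) = mm (iter j.+1 S (f a)),
      forall r, r < L -> forall a : U, mm (g r.+1 a) = mm (S (g r a))
    & forall k, k <= j -> exists2 r, r <= L
        & forall a : U, mm (g r a) = mm (iter k S (f a))].
Proof.
move=> fb; pose c k := [ffun a : U => mm (iter k S (f a))].
have [L [d [LK d0 dL ed dc]]] :=
  shortcut (c := c) (fun k => config_step_iter k fb) j.
have gex r : exists g, branching g /\ (r <= L ->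
    (forall a : U, mm (g a) = d r a) /\ forall a : U, mm (S (g a)) = d r.+1 a).
  have [rL|rL] := boolP (r <= L); last by exists f.
  have /asboolP[g [gb g1 g2]] := ed r rL; by exists g.
have [g gP] := choice gex; exists L, g; split.
- by split=> // r; case: (gP r).
- by move=> a; have [_ /(_ isT)[-> _]] := gP 0; rewrite d0 ffunE.
- by move=> a; have [_ /(_ (leqnn L))[_ ->]] := gP L; rewrite dL ffunE.
- move=> r rL a; have [_ /(_ rL)[-> _]] := gP r.+1.
  by have [_ /(_ (ltnW rL))[_ ->]] := gP r.
- move=> k kj; have [r rL dr] := dc k kj; exists r => // a.
  by have [_ /(_ rL)[-> _]] := gP r; rewrite dr ffunE.
Qed.

Lemma eventually_bound (f : seq Q -> W) : exists N, forall (a : U) i k,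
  exists2 k', k' <= N & (i \in t (iter k' S (f a))) = (i \in t (iter k S (f a))).
Proof.
pose R (x : U * 'I_n * bool) k := (x.1.2 \in t (iter k S (f x.1.1))) = x.2.
have ex x : exists k', (exists k, R x k) -> R x k'.
  by have [[k Rk]|no] := pselect (exists k, R x k); [exists k | exists 0].
have [h hP] := choice ex; exists (\max_x h x) => a i k.
exists (h (a, i, i \in t (iter k S (f a)))); first exact: leq_bigmax.
by apply: (hP (a, i, _)); exists k.
Qed.

Lemma finite_unfolding_exists w0 : inhabited (finite_unfolding w0).
Proof.
have [i irec] := recurrent_value (fun k => mm (iter k S w0)).
pose x0 := iter i.+1 S w0.
have [N NP] := eventually_bound (walk x0).
(* The return time [j.+1] is taken beyond [N], so that one turn of the loop meets every eventuality
   of the tree. *)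
have [j Nj] := irec N; rewrite iterD -/x0 => rec.
(* Before the loop no proper tree has to flow: every node carries the same world. *)
have constb : branching (fun _ => w0) by move=> *; exact: le_refl.
have [p [gp [[pK gpb] gp0 gpp gpn _]]] := shortened_orbit i constb.
have [L [gl [[LK glb] gl0 glL gln glc]]] := shortened_orbit j (@branching_walk x0).
pose F l := if l <= p then gp l else gl (l - p.+1).
have Fp l : l <= p -> F l = gp l by rewrite /F => ->.
have Fl r : F (p.+1 + r) = gl r by rewrite /F addSn ltnNge leq_addr /= -addSn addKn.
have IT : p.+1 < p.+1 + L.+1 by rewrite -[X in X < _]addn0 ltn_add2l.
have Fb l : branching (F l) by rewrite /F; case: ifP.
have Fnext l : l.+1 < p.+1 + L.+1 -> l.+1 != p.+1 ->
    forall a : U, mm (F l.+1 a) = mm (S (F l a)).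
  move=> lT lI a; have [lp|] := ltnP l p; first by rewrite !Fp ?gpn // ltnW.
  rewrite leq_eqVlt eq_sym -eqSS (negPf lI) /= => /subnKC El.
  move: lT; rewrite -El -addnS !Fl ltn_add2l ltnS => rL; exact: gln.
have Freturn l : l < p.+1 + L.+1 -> l.+1 = p.+1 + L.+1 \/ l.+1 = p.+1 ->
    mm x0 = mm (S (F l [::])).
  move=> _ []; [rewrite addnS|] => -[->].
    by rewrite Fl; apply/esym/(etrans (glL [bseq])).
  by rewrite Fp // (gpp [bseq]).
have Fstart (a : U) : mm (F p.+1 a) = mm (walk x0 a).
  by rewrite -[p.+1]addn0 Fl gl0.
have Fev (a : U) m k : exists2 r, p.+1 + r < p.+1 + L.+1 &
    (m \in t (F (p.+1 + r) a)) = (m \in t (iter k S (walk x0 a))).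
  have [k' k'N <-] := NP a m k.
  have [r rL Er] := glc k' (leq_trans k'N Nj).
  by exists r; rewrite ?ltn_add2l // Fl (mom_type (Er a)).
have T0 : 0 < p.+1 + L.+1 by [].
constructor; apply: (@FiniteUnfolding w0 _ (Ordinal T0, [bseq], [bseq])
  (@world_le (p.+1 + L.+1)) (world_succ S F IT) (@label F (p.+1 + L.+1))).
- have q0 : 0 < #|Q| by rewrite card_moment moment_card_gt0.
  have Uu := card_bseq_le n q0; rewrite card_moment in Uu.
  have KK : #|{ffun U -> Q}| <= moment_card n n ^ (n.+1 * moment_card n n ^ n).
    by rewrite card_ffun card_moment leq_pexp2l ?moment_card_gt0.
  rewrite /world !card_prod card_ord !leq_mul ?leq_add ?ltnS //.
    by rewrite (leq_trans pK) // leq_add ?leq_mul.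
  by rewrite (leq_trans LK) // leq_add ?leq_mul.
- exact: world_le_refl.
- exact: world_le_trans.
- exact: world_le_antisym.
- exact: world_succ_mono.
- exact: label_mono.
- by rewrite /label /= Fp // (mom_type (gp0 [bseq])).
- exact: (label_succ S_mono IT Fb Fnext Freturn Fstart).
- exact: label_witness.
- move=> v m; have [k [a [h1 h2]]] := label_eventually IT Fstart Fev v m.
  by exists k, (walk x0 a).
Qed.

End Existence.

End Moments.

(** * The truth lemma *)

Section FiniteModel.
Variables (P : countType) (phi : formula P) (W : Type) (M : dynamic_model P W).

Let Sub := undup (subformulas phi).
Let n := formula_size phi.

Definition model_le : rel W := fun x y => `[< dm_le M x y >].
Definition formula_type (x : W) : {set 'I_n} :=
  [set i : 'I_n | `[< holds M x (nth Bot Sub i) >]].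

Lemma iter_succ_mono k x y : dm_le M x y ->
  dm_le M (iter k (dm_succ M) x) (iter k (dm_succ M) y).
Proof. by move=> xy; elim: k => //= k; apply: dm_succ_mono. Qed.

Lemma holds_mono psi x y : dm_le M x y -> holds M x psi -> holds M y psi.
Proof.
elim: psi x y => [p||f If g Ig|f If g Ig|f If g Ig|f If|f If|f If] x y xy //=.
- exact: dm_val_mono.
- by case=> /(If _ _ xy) ? /(Ig _ _ xy).
- by case=> [/(If _ _ xy)|/(Ig _ _ xy)]; [left|right].
- by move=> h z yz; apply: h; apply: dm_le_trans yz.
- exact/If/dm_succ_mono.
- by case=> k hk; exists k; apply: If hk; apply: iter_succ_mono.
- by move=> h k; apply: If (h k); apply: iter_succ_mono.
Qed.

Lemma formula_type_mem psi : psi \in Sub ->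
  exists i, forall x, (i \in formula_type x) = `[< holds M x psi >].
Proof.
move=> psiS; have ltn : index psi Sub < n by rewrite index_mem.
by exists (Ordinal ltn) => x; rewrite in_set /= nth_index.
Qed.

Lemma formula_type_holds psi x y : psi \in Sub ->
  formula_type x = formula_type y -> holds M x psi -> holds M y psi.
Proof.
move=> /formula_type_mem[i iP] E; move/asboolP; rewrite -iP E iP.
by move/asboolP.
Qed.

Variables (w0 : W).
Variable fu : finite_unfolding model_le formula_type (dm_succ M) w0.

Let lab := @fu_label _ _ _ _ _ _ fu.
Let succ := @fu_succ _ _ _ _ _ _ fu.

Lemma unfolding_val_mono v w : fu_le v w ->
  forall p, dm_val M (lab v) p -> dm_val M (lab w) p.
Proof.
by move=> vw; apply: dm_val_mono; apply/asboolP; apply: (fu_label_mono vw).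
Qed.

Definition unfolding_model : dynamic_model P (fu_world fu) :=
  DynamicModel (inhabits (fu_root fu)) (@fu_refl _ _ _ _ _ _ fu)
    (@fu_trans _ _ _ _ _ _ fu) (@fu_antisym _ _ _ _ _ _ fu)
    (@fu_succ_mono _ _ _ _ _ _ fu) unfolding_val_mono.

Lemma label_succ_holds psi v : psi \in Sub ->
  holds M (lab (succ v)) psi <-> holds M (dm_succ M (lab v)) psi.
Proof.
by move=> psiS; split; apply: formula_type_holds => //; rewrite fu_label_succ.
Qed.

(** If [psi] failed at all iterates, [Dia psi] would stay pending up to an iterate with the type of
    [x]. Then [psi] holds somewhere on the orbit of [x], and [fu_eventually] brings this back to an
    iterate of [v]. *)
Lemma label_Dia psi v : psi \in Sub -> Dia psi \in Sub ->
  (exists k, holds M (lab (iter k succ v)) psi) <-> holds M (lab v) (Dia psi).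
Proof.
move=> psiS dS; split=> [[k hk]|].
  have : holds M (lab (iter k succ v)) (Dia psi) by exists 0.
  elim: k {hk} => // k IH; rewrite iterS => /(label_succ_holds _ dS)[j hj].
  by apply: IH; exists j.+1; rewrite iterSr.
move=> dv; apply: contrapT => /forallNP no.
have pending k : holds M (lab (iter k succ v)) (Dia psi).
  elim: k => // k [[|j] hj]; first by case: (no k).
  by apply/label_succ_holds => //; exists j; rewrite -iterSr.
have [i iP] := formula_type_mem psiS.
have [k [x [tx ev]]] := fu_eventually v i.
have [j hj] := formula_type_holds dS tx (pending k).
have [k' Ek'] := ev j; apply: (no k'); apply/asboolP.
by rewrite -iP Ek' iP; apply/asboolP.
Qed.

(** Dually, [psi] at all iterates gives [psi] on the whole orbit of [x], hence [Box psi] at the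
    iterate with the type of [x]; it is then carried back to [v] step by step. *)
Lemma label_Box psi v : psi \in Sub -> Box psi \in Sub ->
  (forall k, holds M (lab (iter k succ v)) psi) <-> holds M (lab v) (Box psi).
Proof.
move=> psiS bS; split=> [hv|bv k].
  have back k : holds M (lab (iter k succ v)) (Box psi) -> holds M (lab v) (Box psi).
    elim: k => // k IH; rewrite iterS => /(label_succ_holds _ bS) h.
    apply: IH => -[|j]; first exact: hv.
    by rewrite iterSr; apply: (h j).
  have [i iP] := formula_type_mem psiS.
  have [k [x [tx ev]]] := fu_eventually v i.
  apply: (back k); apply: formula_type_holds (esym tx) _ => // j.
  have [k' Ek'] := ev j; apply/asboolP; rewrite -iP -Ek' iP; exact/asboolP.
suff : holds M (lab (iter k succ v)) (Box psi) by move/(_ 0).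
elim: k => // k IH; apply/label_succ_holds => // j.
by rewrite -iterSr; apply: (IH j.+1).
Qed.

Lemma unfolding_truth psi v : {subset subformulas psi <= Sub} ->
  holds unfolding_model v psi <-> holds M (lab v) psi.
Proof.
elim: psi v => [p||f If g Ig|f If g Ig|f If g Ig|f If|f If|f If] v sub //=.
1-3: have [subf subg] : {subset subformulas f <= Sub} /\ {subset subformulas g <= Sub}
  by split=> x xin; apply: sub; rewrite inE mem_cat xin !orbT.
4-6: have subf : {subset subformulas f <= Sub}
  by move=> x xin; apply: sub; rewrite inE xin orbT.
- by rewrite If // Ig.
- by rewrite If // Ig.
- have mf : f \in Sub by apply: subf; case: (f) => *; apply: mem_head.
  have mg : g \in Sub by apply: subg; case: (g) => *; apply: mem_head.
  split=> h.
    (* A node of the unfolding with the type of [y] stands in for [y], since the type decides [f]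
       and [g]. *)
    move=> y vy hf; have [w vw tw] := fu_witness (v := v) (asboolT vy : model_le _ y).
    apply: (formula_type_holds mg tw); apply/Ig => //; apply: h vw _.
    by apply/If => //; apply: formula_type_holds (esym tw) hf.
  move=> w vw /If hf; apply/Ig => //; apply: h (hf subf).
  by apply/asboolP; apply: (fu_label_mono vw).
- rewrite If //; apply: label_succ_holds.
  by apply: subf; case: (f) => *; apply: mem_head.
- apply: iff_trans (label_Dia v (subf _ _) (sub _ (mem_head _ _))); last first.
    by case: (f) => *; apply: mem_head.
  by split=> -[k hk]; exists k; apply/If.
- apply: iff_trans (label_Box v (subf _ _) (sub _ (mem_head _ _))); last first.
    by case: (f) => *; apply: mem_head.
  by split=> h k; apply/If => //; apply: h.
Qed.

End FiniteModel.

(** The equivalence serves satisfiability and falsifiability at once. *)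
Lemma finite_model (P : countType) (phi : formula P) W (M : dynamic_model P W) w :
  exists (V : finType) (N : dynamic_model P V) (v : V),
    #|V| <= model_bound (formula_size phi) /\ (holds N v phi <-> holds M w phi).
Proof.
have refl : reflexive (model_le M) by move=> x; apply/asboolP/dm_le_refl.
have trans : transitive (model_le M).
  move=> y x z /asboolP xy /asboolP yz; apply/asboolP; exact: dm_le_trans xy yz.
have tmono x y : model_le M x y -> formula_type phi M x \subset formula_type phi M y.
  move=> /asboolP xy; apply/subsetP=> i; rewrite !in_set => /asboolP h.
  exact/asboolP/(holds_mono xy).
have smono : {homo dm_succ M : x y / model_le M x y}.
  by move=> x y /asboolP xy; apply/asboolP/dm_succ_mono.
have [fu] := finite_unfolding_exists refl trans tmono smono w.
have phiS : phi \in undup (subformulas phi).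
  by rewrite mem_undup; case: (phi) => *; apply: mem_head.
exists (fu_world fu), (unfolding_model fu), (fu_root fu); split; first exact: fu_card.
rewrite unfolding_truth => [|x]; last by rewrite mem_undup.
by split; apply: (formula_type_holds phiS); rewrite fu_label_root.
Qed.

(** * Computability of the bound *)

Definition recursive k (F : k.-tuple nat -> nat) : Prop :=
  exists f : recfun k, forall v, computes f v (F v).

Lemma recursive_proj k (i : 'I_k) : recursive (fun v => tnth v i).
Proof. by exists (RProj i). Qed.

Lemma recursive_comp m k (G : m.-tuple nat -> nat) (H : 'I_m -> k.-tuple nat -> nat) :
  recursive G -> (forall i, recursive (H i)) ->
  recursive (fun v => G [tuple H i v | i < m]).
Proof.
move=> [g gP] /choice[h hP]; exists (RComp g h) => v.
by exists [tuple H i v | i < m]; split=> // i; rewrite tnth_mktuple.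
Qed.

Lemma recursive_succ k (F : k.-tuple nat -> nat) :
  recursive F -> recursive (fun v => (F v).+1).
Proof.
move=> hF.
have [|f fP] := @recursive_comp 1 k (fun v => (thead v).+1) (fun=> F) _ (fun=> hF).
  by exists RSucc.
by exists f => v; have := fP v; rewrite /thead tnth_mktuple.
Qed.

Lemma recursive_const k c : recursive (fun _ : k.-tuple nat => c).
Proof. by elim: c => [|c]; [exists (RZero k) | apply: recursive_succ]. Qed.

Definition recursive2 (op : nat -> nat -> nat) : Prop :=
  recursive (fun v : 2.-tuple nat => op (tnth v ord0) (tnth v (lift ord0 ord0))).

Lemma recursive_comp2 k op (F G : k.-tuple nat -> nat) :
  recursive2 op -> recursive F -> recursive G -> recursive (fun v => op (F v) (G v)).
Proof.
move=> hop hF hG.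
have [|f fP] := @recursive_comp 2 k _ (fun i => if i == ord0 then F else G) hop.
  by move=> i; case: ifP.
by exists f => v; have := fP v; rewrite !tnth_mktuple.
Qed.

Lemma recursive2_rec op (G : 1.-tuple nat -> nat) (H : 3.-tuple nat -> nat) :
  recursive G -> recursive H ->
  (forall y, op 0 y = G [tuple y]) ->
  (forall x y, op x.+1 y = H [tuple x; op x y; y]) -> recursive2 op.
Proof.
move=> [g gP] [h hP] op0 opS; exists (RPrec g h) => v.
case/tupleP: v => x v; case/tupleP: v => y v; rewrite (tuple0 v) {v}.
exists (op^~ y); split=> //.
  by rewrite op0; have := gP [tuple y]; congr computes; apply: val_inj.
move=> k _; rewrite opS; have := hP [tuple k; op k y; y].
by congr computes; apply: val_inj.
Qed.

Lemma recursive2_add : recursive2 addn.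
Proof.
by apply: (recursive2_rec (recursive_proj ord0)
  (recursive_succ (recursive_proj (lift ord0 ord0)))).
Qed.

Lemma recursive2_mul : recursive2 muln.
Proof.
apply: (recursive2_rec (recursive_const 1 0)
  (recursive_comp2 recursive2_add (recursive_proj ord_max)
     (recursive_proj (lift ord0 ord0)))) => // x y.
Qed.

(** The exponent comes first because [recursive2_rec] recurses on the first argument. *)
Lemma recursive2_exp : recursive2 (fun x y => y ^ x).
Proof.
apply: (recursive2_rec (recursive_const 1 1)
  (recursive_comp2 recursive2_mul (recursive_proj ord_max)
     (recursive_proj (lift ord0 ord0)))) => // x y.
by rewrite expnS.
Qed.

Lemma recursive2_moment_card : recursive2 (fun k n => moment_card n k).
Proof.
apply: (recursive2_rec
  (recursive_comp2 recursive2_exp (recursive_proj ord0) (recursive_const 1 2))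
  (recursive_comp2 recursive2_mul
    (recursive_comp2 recursive2_exp (recursive_proj ord_max) (recursive_const 3 2))
    (recursive_comp2 recursive2_exp (recursive_proj (lift ord0 ord0))
       (recursive_const 3 2)))) => //.
Qed.

Lemma computable_model_bound : computable model_bound.
Proof.
have hn := recursive_proj (ord0 : 'I_1).
have hq := recursive_comp2 recursive2_moment_card hn hn.
have hu := recursive_comp2 recursive2_mul (recursive_succ hn)
             (recursive_comp2 recursive2_exp hn hq).
have hK := recursive_comp2 recursive2_exp hu hq.
have hL := recursive_succ (recursive_comp2 recursive2_add
             (recursive_comp2 recursive2_mul hK hK) hK).
have [f fP] := recursive_comp2 recursive2_mul (recursive_comp2 recursive2_mul
                 (recursive_comp2 recursive2_add hL hL) hu) hu.
by exists f => m; apply: (fP [tuple m]).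
Qed.

Theorem theorem31 (P : countType) :
  exists B : nat -> nat,
    computable B /\
    forall phi : formula P,
      ((exists (W : Type) (M : dynamic_model P W), satisfiable_in M phi) ->
       exists (W : finType) (M : dynamic_model P W),
         #|W| <= B (formula_size phi) /\ satisfiable_in M phi) /\
      ((exists (W : Type) (M : dynamic_model P W), falsifiable_in M phi) ->
       exists (W : finType) (M : dynamic_model P W),
         #|W| <= B (formula_size phi) /\ falsifiable_in M phi).
Proof.
exists model_bound; split=> [|phi]; first exact: computable_model_bound.
split=> -[W [M [w hw]]]; have [V [N [v [cardV Nv]]]] := finite_model phi M w.
  by exists V, N; split=> //; exists v; apply/Nv.
by exists V, N; split=> //; exists v => /Nv.
Qed.
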